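(* Let $K$ be a field and let $X$ and $Y$ be partially ordered sets. There is an anti-isomorphism $D(X,K)\to D(Y,K)$ of $K$-algebras if and only if there is an anti-isomorphism $X\to Y$ of partially ordered sets.
   Context: For a field $K$ and a poset $X$, the incidence space $I(X,K)$ is the $K$-space of functions $f:X\times X\to K$ with $f(x,y)=0$ whenever $x\nleq y$. The finitary incidence algebra $FI(X,K)$ is the subspace of all $f\in I(X,K)$ such that for all $x\le y$ in $X$ there are only finitely many subintervals $[u,v]\subseteq[x,y]$ with $u\ne v$ and $f(u,v)\neq 0$. It is an associative unital $K$-algebra under convolution $(fg)(x,y)=\sum_{x\le z\le y}f(x,z)g(z,y)$, and the same formula makes $I(X,K)$ an $FI(X,K)$-bimodule. $D(X,K)=FI(X,K)(+)I(X,K)$ (the idealization) is the $K$-algebra $FI(X,K)\oplus I(X,K)$, elements written as columns $\begin{bmatrix}f\\ i\end{bmatrix}$, with multiplication $\begin{bmatrix}f\\ i\end{bmatrix}\begin{bmatrix}g\\ j\end{bmatrix}=\begin{bmatrix}fg\\ fj+ig\end{bmatrix}$. An anti-isomorphism of posets $\mu:X\to Y$ is a bijection with $x\le y\Leftrightarrow \mu(y)\le\mu(x)$ for all $x,y\in X$. An anti-isomorphism of $K$-algebras is a bijective $K$-linear map reversing products. *)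

(* Defs.v *)
From HB Require Import structures.
From mathcomp Require Import all_boot all_order all_algebra.
From mathcomp Require Import all_classical.

Set Implicit Arguments.
Unset Strict Implicit.
Unset Printing Implicit Defensive.

Import Order.TTheory GRing.Theory.

Local Open Scope classical_set_scope.
Local Open Scope ring_scope.

Section Convolution.
Variables (d : Order.disp_t) (X : porderType d) (K : fieldType).
Implicit Types f g h : X -> X -> K^o.

Definition is_incidence f := forall x y : X, ~ (x <= y)%O -> f x y = 0.

(* The interval [u, v] is represented by the pair of its endpoints; for an
   incidence function, f u v != 0 already forces u <= v. *)
Definition nonzero_subintervals f (x y : X) : set (X * X) :=
  [set uv | [/\ (x <= uv.1)%O, (uv.1 <= uv.2)%O, (uv.2 <= y)%O,
                uv.1 != uv.2 & f uv.1 uv.2 != 0]].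

Definition is_finitary f :=
  forall x y : X, (x <= y)%O -> finite_set (nonzero_subintervals f x y).

(* \sum_(z \in A) is a sum over the support; it is 0 by convention when the
   support is infinite, which cannot happen when f or g is finitary. *)
Definition conv f g : X -> X -> K^o := fun x y =>
  \sum_(z \in [set z | (x <= z)%O && (z <= y)%O]) (f x z * g z y).

Definition delta : X -> X -> K^o := fun x y => (x == y)%:R.

Local Notation itv x y := [set z : X | (x <= z)%O && (z <= y)%O].

Lemma finite_subintervals f x y :
  is_finitary f -> finite_set (nonzero_subintervals f x y).
Proof.
move=> ff; have [/ff//|nxy] := boolP (x <= y)%O.
apply: (@sub_finite_set _ _ set0); last exact: finite_set0.
move=> [u v] /= [xu uv vy _ _]; case/negP: nxy.
exact: le_trans (le_trans xu uv) vy.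
Qed.

Lemma finite_lsupp f x y :
  is_finitary f -> finite_set [set z | itv x y z /\ f x z != 0].
Proof.
move=> ff; apply: (@sub_finite_set _ _
  ([set x] `|` snd @` nonzero_subintervals f x y)); last first.
  rewrite finite_setU; split; first exact: finite_set1.
  exact/finite_image/finite_subintervals.
move=> z /= [/andP[xz zy] fz]; have [->|nxz] := eqVneq x z; first by left.
by right; exists (x, z) => //; split.
Qed.

Lemma finite_rsupp f x y :
  is_finitary f -> finite_set [set z | itv x y z /\ f z y != 0].
Proof.
move=> ff; apply: (@sub_finite_set _ _
  ([set y] `|` fst @` nonzero_subintervals f x y)); last first.
  rewrite finite_setU; split; first exact: finite_set1.
  exact/finite_image/finite_subintervals.
move=> z /= [/andP[xz zy] fz]; have [->|nzy] := eqVneq z y; first by left.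
by right; exists (z, y) => //; split.
Qed.

Lemma finite_conv_supp f g x y : is_finitary f \/ is_finitary g ->
  finite_set [set z | itv x y z /\ f x z * g z y != 0].
Proof.
case=> [/(@finite_lsupp _ x y)|/(@finite_rsupp _ x y)]; apply: sub_finite_set.
  by move=> z /= [xzy fg]; split=> //; apply: contra_neq fg => ->; rewrite mul0r.
by move=> z /= [xzy fg]; split=> //; apply: contra_neq fg => ->; rewrite mulr0.
Qed.

Lemma conv_neq0 f g x y : conv f g x y != 0 ->
  exists z, [/\ (x <= z)%O, (z <= y)%O, f x z != 0 & g z y != 0].
Proof.
move=> fgN0; apply: contrapT => nz; move/eqP: fgN0; apply.
apply: fsbig1 => z /= /andP[xz zy]; apply: contrapT => /eqP.
by rewrite mulf_eq0 negb_or => /andP[fz gz]; apply: nz; exists z.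
Qed.

Lemma conv_incidence f g : is_incidence (conv f g).
Proof.
move=> x y nxy; apply: contrapT => /eqP/conv_neq0[z [xz zy _ _]].
exact/nxy/(le_trans xz zy).
Qed.

Lemma conv_finitary f g :
  is_finitary f -> is_finitary g -> is_finitary (conv f g).
Proof.
move=> ff fg x y xy.
pose A := nonzero_subintervals f x y; pose B := nonzero_subintervals g x y.
apply: (@sub_finite_set _ _
  (A `|` B `|` (fun p => (p.1.1, p.2.2)) @` (A `*` B))); last first.
  rewrite !finite_setU; split; first by split; exact: finite_subintervals.
  by apply/finite_image/finite_setX; exact: finite_subintervals.
move=> [u v] /= [xu uv vy nuv /conv_neq0[z [uz zv fz gz]]].
have [euz|nuz] := eqVneq u z; first by left; right; split; rewrite //= euz.
have [ezv|nzv] := eqVneq z v; first by left; left; split; rewrite //= -ezv.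
right; exists ((u, z), (z, v)) => //=; split; split=> //=.
  exact: le_trans zv vy.
exact: le_trans xu uz.
Qed.

Lemma fsum_add (P : set X) (F G : X -> K^o) :
    finite_set [set z | P z /\ F z != 0] ->
    finite_set [set z | P z /\ G z != 0] ->
  \sum_(z \in P) (F z + G z) = \sum_(z \in P) F z + \sum_(z \in P) G z.
Proof.
move=> fF fG; pose D := [set z | P z /\ F z != 0] `|` [set z | P z /\ G z != 0].
have fD : finite_set D by rewrite finite_setU.
have DP : D `<=` P by move=> z [] [].
have F0 z : P z -> ~ D z -> F z = 0.
  by move=> Pz nD; apply: contrapT => /eqP Fz; apply: nD; left.
have G0 z : P z -> ~ D z -> G z = 0.
  by move=> Pz nD; apply: contrapT => /eqP Gz; apply: nD; right.
rewrite -!(fsbig_widen D P) //; first exact: fsbig_split.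
- by move=> z [/= Pz nD]; exact: G0.
- by move=> z [/= Pz nD]; exact: F0.
- by move=> z [/= Pz nD]; rewrite F0// G0// addr0.
Qed.

Lemma convDl f f' g : (is_finitary f /\ is_finitary f') \/ is_finitary g ->
  conv (f + f') g = conv f g + conv f' g.
Proof.
move=> fin; apply/funext => x; apply/funext => y; rewrite /conv.
under eq_fsbigr do rewrite mulrDl.
by apply: fsum_add; apply: finite_conv_supp; case: fin => [[]|]; by [left|right].
Qed.

Lemma convDr f g g' : is_finitary f \/ (is_finitary g /\ is_finitary g') ->
  conv f (g + g') = conv f g + conv f g'.
Proof.
move=> fin; apply/funext => x; apply/funext => y; rewrite /conv.
under eq_fsbigr do rewrite mulrDr.
by apply: fsum_add; apply: finite_conv_supp; case: fin => [|[]]; by [left|right].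
Qed.

Lemma convZl k f g : conv (k *: f) g = k *: conv f g.
Proof.
apply/funext => x; apply/funext => y; rewrite /conv.
rewrite [RHS](@mulr_fsumr K).
by apply: eq_fsbigr => z _; rewrite -[RHS]/(k * (f x z * g z y)) mulrA.
Qed.

Lemma convZr k f g : conv f (k *: g) = k *: conv f g.
Proof.
apply/funext => x; apply/funext => y; rewrite /conv.
rewrite [RHS](@mulr_fsumr K).
by apply: eq_fsbigr => z _; rewrite -[RHS]/(k * (f x z * g z y)) mulrCA.
Qed.

Lemma conv1f f : is_incidence f -> conv delta f = f.
Proof.
move=> If; apply/funext => x; apply/funext => y; rewrite /conv.
have [xy|/negP nxy] := boolP (x <= y)%O; last first.
  rewrite If// fsbig1// => z /= /andP[xz zy].
  by case: nxy; exact: le_trans xz zy.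
rewrite -(fsbig_widen [set x]) ?fsbig_set1 /delta ?eqxx ?mul1r//.
  by move=> z -> /=; rewrite lexx.
by move=> z [_ /= /eqP]; rewrite eq_sym => /negbTE->; rewrite mul0r.
Qed.

Lemma convf1 f : is_incidence f -> conv f delta = f.
Proof.
move=> If; apply/funext => x; apply/funext => y; rewrite /conv.
have [xy|/negP nxy] := boolP (x <= y)%O; last first.
  rewrite If// fsbig1// => z /= /andP[xz zy].
  by case: nxy; exact: le_trans xz zy.
rewrite -(fsbig_widen [set y]) ?fsbig_set1 /delta ?eqxx ?mulr1//.
  by move=> z -> /=; rewrite lexx andbT.
by move=> z [_ /= /eqP/negbTE->]; rewrite mulr0.
Qed.

Lemma exchange_fsum (P : set X) (F : X -> X -> K^o) :
    finite_set [set z | P z /\ exists2 w, P w & F z w != 0] ->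
    finite_set [set w | P w /\ exists2 z, P z & F z w != 0] ->
  \sum_(z \in P) \sum_(w \in P) F z w = \sum_(w \in P) \sum_(z \in P) F z w.
Proof.
move=> fA fB; set A := [set z | _] in fA; set B := [set w | _] in fB.
have AP : A `<=` P by move=> z [].
have BP : B `<=` P by move=> z [].
have FA z w : P z -> P w -> ~ A z -> F z w = 0.
  by move=> Pz Pw nA; apply: contrapT => /eqP Fz; apply: nA; split=> //; exists w.
have FB z w : P z -> P w -> ~ B w -> F z w = 0.
  by move=> Pz Pw nB; apply: contrapT => /eqP Fz; apply: nB; split=> //; exists z.
rewrite -(fsbig_widen A P) //; last first.
  by move=> z [/= Pz nA]; apply: fsbig1 => w Pw; exact: FA.
rewrite -[RHS](fsbig_widen B P) //; last first.
  by move=> w [/= Pw nB]; apply: fsbig1 => z Pz; exact: FB.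
transitivity (\sum_(z \in A) \sum_(w \in B) F z w).
  apply: eq_fsbigr => z /set_mem/AP Pz; apply/esym/fsbig_widen => //.
  by move=> w [/= Pw nB]; exact: FB.
rewrite exchange_fsbig//.
apply: eq_fsbigr => w /set_mem/BP Pw; apply/fsbig_widen => //.
by move=> z [/= Pz nA]; exact: FA.
Qed.

Lemma convA f g h : is_incidence f -> is_incidence g -> is_incidence h ->
    [\/ is_finitary f /\ is_finitary g, is_finitary f /\ is_finitary h |
        is_finitary g /\ is_finitary h] ->
  conv f (conv g h) = conv (conv f g) h.
Proof.
move=> If Ig Ih fin; apply/funext => x; apply/funext => y.
pose F z w : K^o := f x z * g z w * h w y.
transitivity (\sum_(z \in itv x y) \sum_(w \in itv x y) F z w).
  apply: eq_fsbigr => z /set_mem /= /andP[xz zy].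
  rewrite /conv [LHS](@mulr_fsumr K); under eq_fsbigr do rewrite mulrA.
  apply: fsbig_widen => w /=; first by move=> /andP[zw ->]; rewrite (le_trans xz zw).
  move=> [/andP[xw wy] /negP nzw].
  rewrite /F Ig ?mulr0 ?mul0r// => zw.
  by move: nzw; rewrite zw wy.
rewrite exchange_fsum; last 2 first.
- case: fin => -[ff fg].
  + apply: sub_finite_set (finite_lsupp x y ff) => z /= [xzy [w _]].
    by rewrite /F !mulf_eq0 !negb_or -andbA => /andP[].
  + apply: sub_finite_set (finite_lsupp x y ff) => z /= [xzy [w _]].
    by rewrite /F !mulf_eq0 !negb_or -andbA => /andP[].
  + apply: (@sub_finite_set _ _ ([set z | itv x y z /\ h z y != 0] `|`
      fst @` nonzero_subintervals g x y)); last first.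
      rewrite finite_setU; split; first exact: finite_rsupp.
      exact/finite_image/finite_subintervals.
    move=> z /= [xzy [w /andP[xw wy]]].
    rewrite /F !mulf_eq0 !negb_or -andbA => /and3P[fz gzw hw].
    have [->|nzw] := eqVneq z w; first by left; rewrite xw wy.
    right; exists (z, w) => //; case/andP: xzy => xz zy; split => //=.
    by apply: contraT => /negP/Ig gz0; rewrite gz0 eqxx in gzw.
- case: fin => -[ff fg].
  + apply: (@sub_finite_set _ _ ([set z | itv x y z /\ f x z != 0] `|`
      snd @` nonzero_subintervals g x y)); last first.
      rewrite finite_setU; split; first exact: finite_lsupp.
      exact/finite_image/finite_subintervals.
    move=> w /= [xwy [z /andP[xz zy]]].
    rewrite /F !mulf_eq0 !negb_or -andbA => /and3P[fz gzw hw].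
    have [<-|nzw] := eqVneq z w; first by left; rewrite xz zy.
    right; exists (z, w) => //; case/andP: xwy => xw wy; split => //=.
    by apply: contraT => /negP/Ig gz0; rewrite gz0 eqxx in gzw.
  + apply: sub_finite_set (finite_rsupp x y fg) => z /= [xzy [w _]].
    by rewrite /F !mulf_eq0 !negb_or => /andP[].
  + apply: sub_finite_set (finite_rsupp x y fg) => z /= [xzy [w _]].
    by rewrite /F !mulf_eq0 !negb_or => /andP[].
apply: eq_fsbigr => w /set_mem /= /andP[xw wy].
rewrite /conv [RHS](@mulr_fsuml K); apply/esym/fsbig_widen => z /=.
  by move=> /andP[-> zw]; rewrite (le_trans zw wy).
move=> [/andP[xz zy] /negP nzw].
rewrite /F Ig ?mulr0 ?mul0r// => zw.
by move: nzw; rewrite xz zw.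
Qed.

Lemma delta_incidence : is_incidence delta.
Proof.
move=> x y nxy; rewrite /delta; case: eqVneq => // exy.
by case: nxy; rewrite exy.
Qed.

Lemma delta_finitary : is_finitary delta.
Proof.
move=> x y _; apply: (@sub_finite_set _ _ set0); last exact: finite_set0.
by move=> [u v] /= [_ _ _ /negbTE uv]; rewrite /delta uv eqxx.
Qed.

Lemma incidence_closed : 
  submod_closed [pred f : X -> X -> K^o | `[< is_incidence f >]].
Proof.
split; first by apply/asboolP.
move=> k f g /asboolP If /asboolP Ig; apply/asboolP => x y nxy.
rewrite -[LHS]/(k *: f x y + g x y).
by rewrite If// Ig// scaler0 addr0.
Qed.

End Convolution.

Section IncidenceSpace.
Variables (d : Order.disp_t) (X : porderType d) (K : fieldType).

Record incidence_space := IncidenceSpace {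
  incidence_fun :> X -> X -> K^o;
  incidence_funP : `[< is_incidence incidence_fun >]
}.

HB.instance Definition _ := [isSub for incidence_fun].
HB.instance Definition _ := [Choice of incidence_space by <:].
HB.instance Definition _ := GRing.SubChoice_isSubLmodule.Build
  K (X -> X -> K^o) _ incidence_space (@incidence_closed d X K).

Lemma incidenceP (f : incidence_space) : is_incidence f.
Proof. exact/asboolP/(incidence_funP f). Qed.

Lemma incidence_funZ k (f : incidence_space) :
  incidence_fun (k *: f) = k *: incidence_fun f.
Proof. by []. Qed.

Lemma finitary_closed :
  submod_closed [pred f : incidence_space | `[< is_finitary f >]].
Proof.
split.
  apply/asboolP => x y _.
  apply: (@sub_finite_set _ _ set0); last exact: finite_set0.
  by move=> [u v] /= [_ _ _ _]; rewrite eqxx.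
move=> k f g /asboolP ff /asboolP fg; apply/asboolP => x y xy.
apply: (@sub_finite_set _ _
  (nonzero_subintervals f x y `|` nonzero_subintervals g x y)).
  move=> [u v] /= [xu uv vy nuv].
  rewrite -[X in X != 0]/(k *: f u v + g u v) => kfg.
  have [f0|fN0] := eqVneq (f u v) 0; last by left.
  by right; split => //=; move: kfg; rewrite f0 scaler0 add0r.
by rewrite finite_setU; split; [exact: ff | exact: fg].
Qed.

End IncidenceSpace.

Section FinitaryIncidenceAlgebra.
Variables (d : Order.disp_t) (X : porderType d) (K : fieldType).
Local Notation I := (incidence_space X K).

Record finitary_incidence_algebra := FinitaryIncidenceAlgebra {
  finitary_val :> incidence_space X K;
  finitary_valP : `[< is_finitary finitary_val >]
}.
Local Notation FI := finitary_incidence_algebra.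

HB.instance Definition _ := [isSub for finitary_val].
HB.instance Definition _ := [Choice of FI by <:].
HB.instance Definition _ := GRing.SubChoice_isSubLmodule.Build
  K I _ FI (@finitary_closed d X K).

Lemma finitaryP (f : FI) : is_finitary f.
Proof. exact/asboolP/(finitary_valP f). Qed.

(* The product of FI and the left and right actions of FI on I are all
   restrictions of inc_mul, which is only meaningful when f or g is finitary. *)
Definition inc_mul (f g : I) : I :=
  IncidenceSpace (asboolT (conv_incidence f g)).

Definition fi_mul (f g : FI) : FI :=
  @FinitaryIncidenceAlgebra (inc_mul f g)
    (asboolT (conv_finitary (finitaryP f) (finitaryP g))).

Definition fi_one : FI :=
  @FinitaryIncidenceAlgebra
    (IncidenceSpace (asboolT (@delta_incidence d X K)))
    (asboolT (@delta_finitary d X K)).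

Lemma inc_mulA (f g h : I) :
    [\/ is_finitary f /\ is_finitary g, is_finitary f /\ is_finitary h |
        is_finitary g /\ is_finitary h] ->
  inc_mul f (inc_mul g h) = inc_mul (inc_mul f g) h.
Proof. by move=> fin; apply/val_inj/convA => //; exact: incidenceP. Qed.

Lemma inc_mul1f (f : I) : inc_mul fi_one f = f.
Proof. exact/val_inj/conv1f/incidenceP. Qed.

Lemma inc_mulf1 (f : I) : inc_mul f fi_one = f.
Proof. exact/val_inj/convf1/incidenceP. Qed.

Lemma inc_mulDl (f f' g : I) :
    (is_finitary f /\ is_finitary f') \/ is_finitary g ->
  inc_mul (f + f') g = inc_mul f g + inc_mul f' g.
Proof. by move=> ?; apply: val_inj; rewrite raddfD; exact: convDl. Qed.

Lemma inc_mulDr (f g g' : I) :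
    is_finitary f \/ (is_finitary g /\ is_finitary g') ->
  inc_mul f (g + g') = inc_mul f g + inc_mul f g'.
Proof. by move=> ?; apply: val_inj; rewrite raddfD; exact: convDr. Qed.

Lemma inc_mulZl k (f g : I) : inc_mul (k *: f) g = k *: inc_mul f g.
Proof.
by apply: val_inj; rewrite [RHS]incidence_funZ -convZl -incidence_funZ.
Qed.

Lemma inc_mulZr k (f g : I) : inc_mul f (k *: g) = k *: inc_mul f g.
Proof.
by apply: val_inj; rewrite [RHS]incidence_funZ -convZr -incidence_funZ.
Qed.

Lemma fi_mulA : associative fi_mul.
Proof.
move=> f g h; apply/val_inj/inc_mulA.
by apply: Or31; split; exact: finitaryP.
Qed.

Lemma fi_mul1f : left_id fi_one fi_mul.
Proof. by move=> f; apply/val_inj/inc_mul1f. Qed.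

Lemma fi_mulf1 : right_id fi_one fi_mul.
Proof. by move=> f; apply/val_inj/inc_mulf1. Qed.

Lemma fi_mulDl : left_distributive fi_mul +%R.
Proof.
move=> f f' g; apply: val_inj; rewrite raddfD.
by apply: inc_mulDl; right; exact: finitaryP.
Qed.

Lemma fi_mulDr : right_distributive fi_mul +%R.
Proof.
move=> f g g'; apply: val_inj; rewrite raddfD.
by apply: inc_mulDr; left; exact: finitaryP.
Qed.

(* FI and the idealization are zero rings when X is empty, so they have no
   algType structure in general (algType requires 1 != 0).  Their algebra
   structure is a pzRingType and an lmodType structure, together with the
   compatibility of scaling with products on both sides. *)
HB.instance Definition _ := GRing.Zmodule_isPzRing.Build FI
  fi_mulA fi_mul1f fi_mulf1 fi_mulDl fi_mulDr.

Lemma fi_scaleAl k (f g : FI) : k *: (f * g) = (k *: f) * g.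
Proof. by apply: val_inj; rewrite linearZ; exact/esym/inc_mulZl. Qed.

Lemma fi_scaleAr k (f g : FI) : k *: (f * g) = f * (k *: g).
Proof. by apply: val_inj; rewrite linearZ; exact/esym/inc_mulZr. Qed.

End FinitaryIncidenceAlgebra.

Section Idealization.
Variables (d : Order.disp_t) (X : porderType d) (K : fieldType).
Local Notation I := (incidence_space X K).
Local Notation FI := (finitary_incidence_algebra X K).

Definition idealization := (FI * I)%type.
Local Notation D := idealization.

HB.instance Definition _ := GRing.Lmodule.copy D (FI * I)%type.

Definition id_mul (a b : D) : D :=
  (a.1 * b.1, inc_mul a.1 b.2 + inc_mul a.2 b.1).

Definition id_one : D := (1, 0).

Lemma id_mulA : associative id_mul.
Proof.
move=> [f i] [g j] [h k]; rewrite /id_mul /=; congr pair; first exact: mulrA.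
have [Ff Fg Fh] := And3 (finitaryP f) (finitaryP g) (finitaryP h).
rewrite inc_mulDr; last by left.
rewrite inc_mulDl; last by right.
rewrite !inc_mulA ?addrA//; by [apply: Or31|apply: Or32|apply: Or33].
Qed.

Lemma inc_mul0f (f : FI) : inc_mul 0 f = 0 :> I.
Proof. by rewrite -[X in inc_mul X _](scale0r (0 : I)) inc_mulZl scale0r. Qed.

Lemma inc_mulf0 (f : FI) : inc_mul f 0 = 0 :> I.
Proof. by rewrite -[X in inc_mul _ X](scale0r (0 : I)) inc_mulZr scale0r. Qed.

Lemma id_mul1f : left_id id_one id_mul.
Proof.
by move=> [f i]; rewrite /id_mul /= mul1r inc_mul1f inc_mul0f addr0.
Qed.

Lemma id_mulf1 : right_id id_one id_mul.
Proof.
by move=> [f i]; rewrite /id_mul /= mulr1 inc_mulf1 inc_mulf0 add0r.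
Qed.

Lemma id_mulDl : left_distributive id_mul +%R.
Proof.
move=> [f i] [f' i'] [g j]; rewrite /id_mul /=; congr pair; first exact: mulrDl.
rewrite inc_mulDl; last by left; split; exact: finitaryP.
rewrite inc_mulDl; last by right; exact: finitaryP.
by rewrite addrACA.
Qed.

Lemma id_mulDr : right_distributive id_mul +%R.
Proof.
move=> [f i] [g j] [g' j']; rewrite /id_mul /=; congr pair; first exact: mulrDr.
rewrite inc_mulDr; last by left; exact: finitaryP.
rewrite inc_mulDr; last by right; split; exact: finitaryP.
by rewrite addrACA.
Qed.

HB.instance Definition _ := GRing.Zmodule_isPzRing.Build D
  id_mulA id_mul1f id_mulf1 id_mulDl id_mulDr.

Lemma id_scaleAl k (a b : D) : k *: (a * b) = (k *: a) * b.
Proof.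
case: a b => [f i] [g j]; congr pair => /=; first exact: fi_scaleAl.
by rewrite scalerDr -!inc_mulZl.
Qed.

Lemma id_scaleAr k (a b : D) : k *: (a * b) = a * (k *: b).
Proof.
case: a b => [f i] [g j]; congr pair => /=; first exact: fi_scaleAr.
by rewrite scalerDr -!inc_mulZr.
Qed.

End Idealization.

Definition idealization_anti_isomorphism (K : fieldType) (dX dY : Order.disp_t)
    (X : porderType dX) (Y : porderType dY)
    (phi : idealization X K -> idealization Y K) : Prop :=
  [/\ bijective phi, linear phi & forall a b, phi (a * b) = phi b * phi a].

Definition poset_anti_isomorphism (dX dY : Order.disp_t)
    (X : porderType dX) (Y : porderType dY) (mu : X -> Y) : Prop :=
  bijective mu /\ forall x y, (x <= y)%O <-> (mu y <= mu x)%O.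

(* Main.v *)
Require Import Defs.
From mathcomp Require Import all_boot all_order all_algebra.
From mathcomp Require Import finmap all_classical.

(** An anti-isomorphism [mu] of posets induces one of algebras by reversing
    arguments: [f] is sent to [(u, v) |-> f (mu^-1 v) (mu^-1 u)].

    Conversely, the poset [X] can be read off the ring [D(X, K)]. For [x] in
    [X] let [e_x] be the idempotent whose first component is the matrix unit
    at [(x, x)] and whose second component is [0]. Call two idempotents
    equivalent when they are [ab] and [ba] for some [a], [b].
    - The corner [e_x D e_y] is nonzero exactly when [x <= y]
      ([links_pointP]); since nonvanishing of a corner [e D f] depends only on
      the equivalence classes of [e] and [f], equivalent [e_x] and [e_y] have
      [x = y] ([point_equiv_eq]).
    - The corner [e_x D e_x] is the algebra of dual numbers over [K], so its
      only idempotents are [0] and [e_x] ([point_primitive]).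
    - A nonzero idempotent [e] of [D] has a nonzero entry on the diagonal of
      its first component ([idem_neq0_diag]): a finitary idempotent [f] with
      zero diagonal vanishes, because [f x y != 0] would give [z] strictly
      between [x] and [y] with [f x z != 0], and the finite set of
      nonzero subintervals would shrink for ever.
    Now let [phi] be an anti-isomorphism and [E = phi e_x]. If [y] is a point
    where the diagonal of [E] is nonzero, then [e_y E e_y] is invertible in
    [e_y D e_y], which makes [e_y] equivalent to a nonzero idempotent of
    [E D E]; by primitivity this idempotent is [E] ([primitive_equiv],
    [anti_point]). Sending [x] to [y] defines a map [X -> Y]; the same
    construction for the inverse of [phi] gives the inverse map, and the order
    is reversed because [phi] exchanges the two sides of a corner. *)

Set Implicit Arguments.
Unset Strict Implicit.
Unset Printing Implicit Defensive.

Import Order.TTheory GRing.Theory.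

Local Open Scope classical_set_scope.
Local Open Scope ring_scope.

(** * Equivalence of idempotents in a ring *)

Section IdempotentEquivalence.
Variable R : pzRingType.
Implicit Types e f g : R.

(** Murray-von Neumann equivalence. It is an equivalence relation only among
    idempotents, whence the side conditions of the lemmas below. *)
Definition idem_equiv e f := exists a b : R, e = a * b /\ f = b * a.

Definition idem (e : R) := e * e = e.

Lemma idem_equiv_sym e f : idem_equiv e f -> idem_equiv f e.
Proof. by move=> [a [b [-> ->]]]; exists b, a. Qed.

Lemma idem_equiv_trans e f g : idem e -> idem g ->
  idem_equiv e f -> idem_equiv f g -> idem_equiv e g.
Proof.
move=> ee gg [a [b [eab fba]]] [c [d [fcd gdc]]]; exists (a * c), (d * b).
split.
  transitivity (a * f * b); last by rewrite fcd !mulrA.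
  by rewrite -[LHS]ee eab fba !mulrA.
transitivity (d * f * c); last by rewrite fba !mulrA.
by rewrite -[LHS]gg gdc fcd !mulrA.
Qed.

(** The corner [e R f] is not zero. *)
Definition links e f := exists a : R, e * a * f <> 0.

Lemma links_equiv e e' f f' : idem e -> idem f ->
  idem_equiv e e' -> idem_equiv f f' -> links e f -> links e' f'.
Proof.
move=> ee ff [a [b [eab eba]]] [c [d [fcd fdc]]] [r er].
exists (b * r * c) => h; apply: er.
transitivity (a * (e' * (b * r * c) * f') * d); last by rewrite h mulr0 mul0r.
by rewrite -{1}ee -{1}ff eab eba fcd fdc !mulrA.
Qed.

(** The corner of [e] has no idempotents besides [0] and [e]. *)
Definition primitive e :=
  forall g, idem g -> e * g * e = g -> g = 0 \/ g = e.

(** If [p * e * p] is right invertible in the corner of [p], then [p] is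
    equivalent to a nonzero idempotent of the corner of [e]. *)
Lemma primitive_equiv e p v : idem e -> idem p -> p <> 0 ->
  p * v = v -> p * e * p * v = p -> primitive e -> idem_equiv p e.
Proof.
move=> ee pp p0 pv pepv prim_e.
have peev : p * e * (e * v) = p.
  by rewrite mulrA -(mulrA p) ee -[in LHS]pv mulrA.
exists (p * e), (e * v); split=> //.
have gg : idem (e * v * (p * e)).
  by rewrite /idem -(mulrA (e * v)) (mulrA (p * e)) peev (mulrA p) pp.
case: (prim_e _ gg) => // [|g0]; first by rewrite !mulrA ee -(mulrA _ e e) ee.
case: p0; rewrite -pp -{1}peev -peev -mulrA (mulrA (e * v)) g0 mul0r mulr0 //.
Qed.

End IdempotentEquivalence.

(** * Matrix units and corners of the idealization *)

Section MatrixUnits.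
Variables (d : Order.disp_t) (X : porderType d) (K : fieldType).
Local Notation I := (incidence_space X K).
Local Notation FI := (finitary_incidence_algebra X K).
Local Notation D := (idealization X K).

(** The matrix unit at [(x, y)]; it is defined for all [x] and [y], and is [0]
    unless [x <= y]. *)
Definition unit_fun (x y : X) : X -> X -> K^o :=
  fun u v => [&& u == x, v == y & (x <= y)%O]%:R.

Lemma unit_incidence x y : is_incidence (unit_fun x y).
Proof.
move=> u v nuv; rewrite /unit_fun; case: eqVneq => //= ux.
by case: eqVneq => //= vy; rewrite -ux -vy; case: (boolP (u <= v)%O).
Qed.

Lemma unit_finitary x y : is_finitary (unit_fun x y).
Proof.
move=> u v _; apply: (@sub_finite_set _ _ [set (x, y)]); last exact: finite_set1.
move=> [z w] /= [_ _ _ _]; rewrite /unit_fun.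
by case: (eqVneq z x) => [->|_]; case: (eqVneq w y) => [->|_]; rewrite /= ?eqxx.
Qed.

Definition fi_unit (x y : X) : FI :=
  @FinitaryIncidenceAlgebra _ _ _
    (IncidenceSpace (asboolT (@unit_incidence x y)))
    (asboolT (@unit_finitary x y)).

Lemma fi_unitE x y u v :
  fi_unit x y u v = [&& u == x, v == y & (x <= y)%O]%:R.
Proof. by []. Qed.

Lemma inc_mul0r (i : I) : inc_mul 0 i = 0.
Proof. by rewrite -[X in inc_mul X _](scale0r (0 : I)) inc_mulZl scale0r. Qed.

Lemma inc_mulr0 (i : I) : inc_mul i 0 = 0.
Proof. by rewrite -[X in inc_mul _ X](scale0r (0 : I)) inc_mulZr scale0r. Qed.

Lemma inc_mul_unitl x (f : I) u v :
  inc_mul (fi_unit x x) f u v = if u == x then f u v else 0.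
Proof.
rewrite -[LHS]/(conv _ _ u v); case: eqVneq => [->|nux]; last first.
  by apply: fsbig1 => z _; rewrite fi_unitE (negbTE nux) mul0r.
transitivity (conv (@delta _ X K) f x v); last by rewrite conv1f//; exact: incidenceP.
rewrite /conv; apply: eq_fsbigr => z _.
by rewrite fi_unitE eqxx lexx andbT /= /delta eq_sym.
Qed.

Lemma inc_mul_unitr x (f : I) u v :
  inc_mul f (fi_unit x x) u v = if v == x then f u v else 0.
Proof.
rewrite -[LHS]/(conv _ _ u v); case: eqVneq => [->|nvx]; last first.
  by apply: fsbig1 => z _; rewrite fi_unitE (negbTE nvx) andbF mulr0.
transitivity (conv f (@delta _ X K) u x); last by rewrite convf1//; exact: incidenceP.
rewrite /conv; apply: eq_fsbigr => z _.
by rewrite fi_unitE eqxx lexx !andbT /delta.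
Qed.

Lemma inc_unit_corner x y (f : I) :
  inc_mul (inc_mul (fi_unit x x) f) (fi_unit y y) = (f x y : K) *: (fi_unit x y : I).
Proof.
apply/val_inj/funext => u; apply/funext => v; rewrite [LHS]inc_mul_unitr.
rewrite inc_mul_unitl -[RHS]/(f x y * fi_unit x y u v) fi_unitE.
case: (eqVneq v y) => [->|_] /=; last by rewrite andbF mulr0.
case: (eqVneq u x) => [->|_] /=; last by rewrite mulr0.
by case: (boolP (x <= y)%O) => [|/negP/incidenceP ->]; rewrite ?mulr1 ?mulr0.
Qed.

(** The element of the idealization with components [c] and [k] times the
    matrix unit at [(x, y)]. *)
Definition id_unit (x y : X) (c k : K) : D :=
  (c *: fi_unit x y, k *: (fi_unit x y : I)).

(** The idempotent [e_x]. *)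
Definition id_point (x : X) : D := id_unit x x 1 0.

Lemma id_mulE (a b : D) :
  a * b = (a.1 * b.1, inc_mul a.1 b.2 + inc_mul a.2 b.1).
Proof. by []. Qed.

Lemma id_corner x y (a : D) :
  id_point x * a * id_point y = id_unit x y (a.1 x y) (a.2 x y).
Proof.
rewrite !id_mulE /id_point /id_unit /= !scale1r !scale0r; congr pair.
  by apply: val_inj; exact: (inc_unit_corner x y a.1).
by rewrite inc_mulr0 inc_mul0r addr0 add0r inc_unit_corner.
Qed.

Lemma id_unit_fst x y c k : (x <= y)%O -> (id_unit x y c k).1 x y = c.
Proof.
by move=> xy; rewrite -[LHS]/(c * fi_unit x y x y) fi_unitE !eqxx xy mulr1.
Qed.

Lemma id_unit_snd x y c k : (x <= y)%O -> (id_unit x y c k).2 x y = k.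
Proof.
by move=> xy; rewrite -[LHS]/(k * fi_unit x y x y) fi_unitE !eqxx xy mulr1.
Qed.

Lemma fi_unit_idem x : fi_unit x x * fi_unit x x = fi_unit x x.
Proof.
apply/val_inj/val_inj/funext => u; apply/funext => v.
rewrite [LHS]inc_mul_unitl -[RHS]/(fi_unit x x u v) !fi_unitE.
by case: ifP => // ->.
Qed.

(** The corner at [x] multiplies like the dual numbers [c + k eps]. *)
Lemma id_unitM x c k c' k' :
  id_unit x x c k * id_unit x x c' k' = id_unit x x (c * c') (c * k' + k * c').
Proof.
have xx := fi_unit_idem x; set E := fi_unit x x in xx; pose EI : I := E.
have xxI : inc_mul EI EI = EI by rewrite /EI -{3}xx.
congr pair.
  by rewrite -[LHS]/((c *: E) * (c' *: E)) -fi_scaleAl -fi_scaleAr xx scalerA.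
rewrite -[LHS]/(inc_mul (c *: EI) (k' *: EI) + inc_mul (k *: EI) (c' *: EI)).
by rewrite !inc_mulZl !inc_mulZr xxI !scalerA scalerDl.
Qed.

Lemma id_unit_eq0 x y c k : ~ (x <= y)%O -> id_unit x y c k = 0.
Proof.
move=> nxy; have E0 : fi_unit x y = 0.
  apply/val_inj/val_inj/funext => u; apply/funext => v.
  by rewrite [LHS]fi_unitE; move/negP/negbTE: nxy => ->; rewrite !andbF.
by rewrite /id_unit E0 !scaler0.
Qed.

Lemma id_point_idem x : idem (id_point x).
Proof. by rewrite /idem id_unitM mulr1 mulr0 mul0r addr0. Qed.

Lemma id_point_neq0 x : id_point x <> 0.
Proof.
move=> h; have := congr1 (fun a : D => a.1 x x) h; rewrite id_unit_fst// => /eqP.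
by rewrite oner_eq0.
Qed.

Lemma links_pointP x y : links (id_point x) (id_point y) <-> (x <= y)%O.
Proof.
split=> [[a]|xy].
  by rewrite id_corner => n0; apply: contrapT => /id_unit_eq0.
exists (id_unit x y 1 0); rewrite id_corner id_unit_fst// => h.
have := congr1 (fun a : D => a.1 x y) h; rewrite id_unit_fst// => /eqP.
by rewrite oner_eq0.
Qed.

Lemma point_equiv_eq x y : idem_equiv (id_point x) (id_point y) -> x = y.
Proof.
have pp := id_point_idem; have refl z : idem_equiv (id_point z) (id_point z).
  by exists (id_point z), (id_point z); rewrite pp.
move=> xy; apply/eqP; rewrite eq_le; apply/andP; split.
  by apply/links_pointP; apply: (links_equiv _ _ (refl x) xy) => //; apply/links_pointP.
by apply/links_pointP; apply: (links_equiv _ _ xy (refl x)) => //; apply/links_pointP.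
Qed.

Lemma point_primitive x : primitive (id_point x).
Proof.
move=> g; rewrite id_corner; move: (g.1 _ _) (g.2 _ _) => c k gg gE; move: gg.
rewrite -gE /idem id_unitM => h.
have /eqP cc : c * c = c by have := id_unit_fst (c * c) (c * k + k * c) (lexx x);
  rewrite h id_unit_fst.
have kk : c * k + k * c = k by have := id_unit_snd (c * c) (c * k + k * c) (lexx x);
  rewrite h id_unit_snd.
move: cc; rewrite -subr_eq0 -{3}(mulr1 c) -mulrBr mulf_eq0 subr_eq0.
case/orP => /eqP c01; move: kk; rewrite c01.
  rewrite mul0r mulr0 addr0 => <-; left.
  by rewrite /id_unit !scale0r.
rewrite mul1r mulr1 => /eqP; rewrite -subr_eq0 addrK => /eqP ->; by right.
Qed.

(** An element of the corner at [x] is invertible there as soon as its first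
    coordinate is nonzero; only a right inverse is needed. *)
Lemma id_point_corner_inv x (a : D) : a.1 x x != 0 ->
  exists2 v, id_point x * v = v & id_point x * a * id_point x * v = id_point x.
Proof.
rewrite id_corner; move: (a.1 x x) (a.2 x x) => c k c0.
(* The inverse in the dual numbers: 1 / (c + k eps) = 1 / c - (k / c ^ 2) eps. *)
exists (id_unit x x c^-1 (- (k * c^-1 * c^-1))).
  by rewrite id_unitM !mul1r mul0r addr0.
by rewrite id_unitM mulfV// mulrN mulrCA mulfV// mulr1 addNr.
Qed.

(** * Idempotents are detected on the diagonal *)

Lemma finitary_idem_eq0 (f : FI) :
  f * f = f -> (forall x, f x x = 0) -> f = 0.
Proof.
move=> ff f0; apply/val_inj/val_inj/funext => x; apply/funext => y.
suff H n : forall x y, (#|` fset_set (nonzero_subintervals f x y)|%fset < n)%N ->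
    f x y = 0 by exact: (H _.+1).
elim: n => // n IHn {}x {}y; rewrite ltnS => le_n.
apply: contrapT => /eqP fxy; move: (fxy); rewrite -{1}ff.
case/conv_neq0=> z [xz zy fxz fzy].
have nxy : x != y by apply: contra_neq fxy => <-.
have nzy : z != y by apply: contra_neq fzy => ->.
(* [(x, y)] is a nonzero subinterval of [x, y] but not of [x, z], so the
   induction hypothesis applies to [f x z]. *)
move/eqP: fxz; apply; apply: IHn; apply: leq_trans le_n.
have fin u v := @finite_subintervals _ _ _ _ u v (@finitaryP _ _ _ f).
apply: fproper_ltn_card; rewrite fproperEneq; apply/andP; split.
  apply/eqP => /fsetP/(_ (x, y)); rewrite !in_fset_set//.
  rewrite (@mem_set _ (nonzero_subintervals f x y)); last first.
    by split=> //=; exact: le_trans zy.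
  move=> /set_mem[_ /= _ yz _ _].
  by move/negP: nzy; apply; rewrite eq_le zy yz.
rewrite -fset_set_sub// => -[u v] [xu uv vz nuv fuv]; split => //.
exact: le_trans zy.
Qed.

Lemma idem_neq0_diag (e : D) : idem e -> e <> 0 -> exists x, e.1 x x != 0.
Proof.
move=> ee e0; apply: contrapT => nx; apply: e0.
have e1 : e.1 = 0.
  apply: finitary_idem_eq0; first by have /(congr1 fst) := ee.
  by move=> x; apply: contrapT => /eqP h; apply: nx; exists x.
have := congr1 snd ee; rewrite -[LHS]/(inc_mul e.1 e.2 + inc_mul e.2 e.1).
rewrite e1 inc_mul0r inc_mulr0 addr0 => e2.
by case: e e1 e2 {ee nx} => [? ?] /= -> <-.
Qed.

End MatrixUnits.

(** * The map of points induced by an anti-isomorphism *)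

Section PointCorrespondence.
Variables (K : fieldType) (dX dY : Order.disp_t).
Variables (X : porderType dX) (Y : porderType dY).
Variable phi : idealization X K -> idealization Y K.
Variable psi : idealization Y K -> idealization X K.
Hypothesis phiK : cancel phi psi.
Hypothesis psiK : cancel psi phi.
Hypothesis phi0 : phi 0 = 0.
Hypothesis phiM : forall a b, phi (a * b) = phi b * phi a.

Lemma anti_inverse a b : psi (a * b) = psi b * psi a.
Proof. by rewrite -[RHS]phiK phiM !psiK. Qed.

Lemma anti_idem e : idem e -> idem (phi e).
Proof. by rewrite /idem -phiM => ->. Qed.

Lemma anti_equiv e f : idem_equiv e f -> idem_equiv (phi e) (phi f).
Proof. by move=> [a [b [-> ->]]]; exists (phi b), (phi a); rewrite !phiM. Qed.

Lemma anti_links e f : links e f -> links (phi f) (phi e).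
Proof.
move=> [a eaf]; exists (phi a); rewrite -!phiM mulrA => h; apply: eaf.
by rewrite -[LHS]phiK h -phi0 phiK.
Qed.

Lemma anti_primitive e : primitive e -> primitive (phi e).
Proof.
move=> prim_e g gg ege; have [||h|h] := prim_e (psi g).
- by rewrite /idem -anti_inverse gg.
- by rewrite -{1 2}[e]phiK -!anti_inverse mulrA ege.
- by left; rewrite -(psiK g) h.
- by right; rewrite -h psiK.
Qed.

Lemma anti_point x : exists y, idem_equiv (phi (id_point K x)) (id_point K y).
Proof.
set E := phi _; have EE : idem E by exact/anti_idem/id_point_idem.
have [y Ey] : exists y, E.1 y y != 0.
  apply: idem_neq0_diag => // E0; apply: (@id_point_neq0 _ X K x).
  by rewrite -[LHS]phiK -/E E0 -phi0 phiK.
exists y; apply: idem_equiv_sym.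
have [v pv pEpv] := id_point_corner_inv Ey.
apply: (primitive_equiv _ (@id_point_idem _ _ _ _) _ pv pEpv) => //.
  exact: id_point_neq0.
apply: anti_primitive; exact: point_primitive.
Qed.

End PointCorrespondence.

Lemma anti_point_map (K : fieldType) (dX dY : Order.disp_t)
    (X : porderType dX) (Y : porderType dY)
    (phi : idealization X K -> idealization Y K) :
  idealization_anti_isomorphism phi ->
  exists mu : X -> Y, poset_anti_isomorphism mu.
Proof.
move=> [[psi phiK psiK] philin phiM].
have phi0 : phi 0 = 0.
  by have := philin (-1) 0 0; rewrite scaler0 addr0 scaleN1r addNr.
have psi0 : psi 0 = 0 by rewrite -phi0 phiK.
have psiM := anti_inverse phiK psiK phiM.
have [mu muP] := choice (anti_point phiK psiK phi0 phiM).
have [nu nuP] := choice (anti_point psiK phiK psi0 psiM).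
have pp := id_point_idem.
exists mu; split.
  exists nu => [x|y]; apply: (@point_equiv_eq _ _ K).
    apply: (idem_equiv_trans _ _ (idem_equiv_sym (nuP _))) => //.
    by have := anti_equiv psiM (idem_equiv_sym (muP x)); rewrite phiK.
  apply: (idem_equiv_trans _ _ (idem_equiv_sym (muP _))) => //.
  by have := anti_equiv phiM (idem_equiv_sym (nuP y)); rewrite psiK.
have pphi x : idem (phi (id_point K x)) by exact/anti_idem/pp.
move=> x x'; split=> [/(links_pointP K)|/(links_pointP K)] h; apply/(links_pointP K).
  exact: links_equiv (muP x') (muP x) (anti_links phiK phi0 phiM h).
have mu' z := idem_equiv_sym (muP z).
have := anti_links psiK psi0 psiM (links_equiv (pp _ _ _ _) (pp _ _ _ _) (mu' x') (mu' x) h).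
by rewrite !phiK.
Qed.

(** * Reversing arguments along a poset anti-isomorphism *)

Section Reversal.
Variables (K : fieldType) (dX dY : Order.disp_t).
Variables (X : porderType dX) (Y : porderType dY).
Variable nu : Y -> X.
Hypothesis nu_bij : bijective nu.
Hypothesis nu_anti : forall u v, (nu v <= nu u)%O = (u <= v)%O.

(** Transport along the inverse [nu : Y -> X] of an anti-isomorphism [X -> Y]. *)
Definition reverse (f : X -> X -> K^o) : Y -> Y -> K^o :=
  fun u v => f (nu v) (nu u).

Lemma reverse_incidence f : is_incidence f -> is_incidence (reverse f).
Proof. by move=> If u v nuv; apply: If; rewrite nu_anti. Qed.

Lemma reverse_finitary f : is_finitary f -> is_finitary (reverse f).
Proof.
have [mu nuK muK] := nu_bij; move=> ff u v uv.
have := ff (nu v) (nu u); rewrite nu_anti => /(_ uv) fin.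
apply: (@sub_finite_set _ _ ((fun p => (mu p.2, mu p.1)) @`
  nonzero_subintervals f (nu v) (nu u))); last exact: finite_image.
move=> [w z] /= [uw wz zv nwz fwz]; exists (nu z, nu w); last by rewrite /= !nuK.
by split; rewrite //= ?nu_anti// (inj_eq (bij_inj nu_bij)) eq_sym.
Qed.

Lemma reverse_conv f g : reverse (conv f g) = conv (reverse g) (reverse f).
Proof.
apply/funext => u; apply/funext => v; have [mu nuK muK] := nu_bij.
rewrite /reverse /conv (reindex_fsbig nu [set z | (u <= z)%O && (z <= v)%O]).
  by apply: eq_fsbigr => z _; rewrite mulrC.
split.
- by move=> z /= /andP[uz zv]; rewrite !nu_anti zv uz.
- by move=> z w _ _; exact: bij_inj.
- move=> z /= zuv; exists (mu z); last exact: muK.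
  by move: zuv; rewrite -(muK z) !nu_anti andbC muK.
Qed.

Definition inc_reverse (f : incidence_space X K) : incidence_space Y K :=
  IncidenceSpace (asboolT (reverse_incidence (incidenceP f))).

Definition fi_reverse (f : finitary_incidence_algebra X K) :
    finitary_incidence_algebra Y K :=
  @FinitaryIncidenceAlgebra _ _ _ (inc_reverse f)
    (asboolT (reverse_finitary (finitaryP f))).

Definition id_reverse (a : idealization X K) : idealization Y K :=
  (fi_reverse a.1, inc_reverse a.2).

Lemma inc_reverseM f g :
  inc_reverse (inc_mul f g) = inc_mul (inc_reverse g) (inc_reverse f).
Proof. exact/val_inj/reverse_conv. Qed.

Lemma id_reverse_linear : linear id_reverse.
Proof.
move=> c a b; congr pair; first exact/val_inj/val_inj.
exact/val_inj.
Qed.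

Lemma id_reverseM a b : id_reverse (a * b) = id_reverse b * id_reverse a.
Proof.
congr pair; first exact/val_inj/inc_reverseM.
rewrite addrC; transitivity (inc_reverse (inc_mul a.2 b.1) + inc_reverse (inc_mul a.1 b.2)).
  by rewrite addrC; exact/val_inj.
by rewrite !inc_reverseM addrC.
Qed.

End Reversal.

Lemma id_reverseK (K : fieldType) (dX dY : Order.disp_t)
    (X : porderType dX) (Y : porderType dY) (mu : X -> Y) (nu : Y -> X)
    (bmu : bijective mu) (bnu : bijective nu)
    (amu : forall u v, (mu v <= mu u)%O = (u <= v)%O)
    (anu : forall u v, (nu v <= nu u)%O = (u <= v)%O) :
  cancel mu nu -> cancel (@id_reverse K _ _ _ _ _ bnu anu) (id_reverse bmu amu).
Proof.
move=> muK [f i]; congr pair; last first.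
  by apply/val_inj/funext => u; apply/funext => v; rewrite /= /reverse !muK.
apply/val_inj/val_inj/funext => u; apply/funext => v.
by rewrite /= /reverse !muK.
Qed.

Theorem theorem3p4 (K : fieldType) (dX dY : Order.disp_t)
    (X : porderType dX) (Y : porderType dY) :
  (exists phi : idealization X K -> idealization Y K,
     idealization_anti_isomorphism phi) <->
  (exists mu : X -> Y, poset_anti_isomorphism mu).
Proof.
split=> [[phi]|[mu [bmu muP]]]; first exact: anti_point_map.
have [nu muK nuK] := bmu; have bnu : bijective nu by exists mu.
have amu u v : (mu v <= mu u)%O = (u <= v)%O by apply/idP/idP => /muP.
have anu u v : (nu v <= nu u)%O = (u <= v)%O by rewrite -amu !nuK.
exists (id_reverse bnu anu); split.
- by exists (id_reverse bmu amu); exact: id_reverseK.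
- exact: id_reverse_linear.
- exact: id_reverseM.
Qed.
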